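(* Let $\mathcal{M}$ be a Type $\mathcal{B}$ surface with $\rho_\nabla\neq0$ which is not strongly projectively flat. Then $\dim\{E(-1,\nabla)\}=0$ except when $\mathcal{M}$ is linearly equivalent to a surface in one of the following cases, where $\dim\{E(-1,\nabla)\}=1$: \begin{enumerate} \item $C_{22}{}^1=0$, $C_{22}{}^2=C_{12}{}^1\neq0$. \item $C_{22}{}^1=\varepsilon$, $C_{12}{}^1=0$, $C_{22}{}^2=2\varepsilon C_{11}{}^2\neq0$, $C_{11}{}^1=1+2C_{12}{}^2+\varepsilon(C_{11}{}^2)^2$, for some $\varepsilon\in\{+1,-1\}$. \end{enumerate}
   Context: A Type $\mathcal{B}$ surface is $M=\mathbb{R}^+\times\mathbb{R}$ with coordinates $(x^1,x^2)$, $x^1>0$, and a torsion free connection $\nabla$, $\nabla_{\partial_{x^i}}\partial_{x^j}=\Gamma_{ij}{}^k\partial_{x^k}$, with Christoffel symbols $\Gamma_{ij}{}^k=(x^1)^{-1}C_{ij}{}^k$ where $C_{ij}{}^k=C_{ji}{}^k\in\mathbb{R}$ are constants, and which is not flat. Two Type $\mathcal{B}$ surfaces are linearly equivalent if they are intertwined by some map $(x^1,x^2)\mapsto(x^1,ax^1+bx^2)$ with $a,b\in\mathbb{R}$, $b\neq0$. With $R_\nabla(x,y)=\nabla_x\nabla_y-\nabla_y\nabla_x-\nabla_{[x,y]}$, the Ricci tensor is $\rho_\nabla(x,y)=\operatorname{Tr}\{z\mapsto R_\nabla(z,x)y\}$ and its symmetrization is $\rho_{s,\nabla}(x,y)=\frac12\{\rho_\nabla(x,y)+\rho_\nabla(y,x)\}$.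 The Hessian is $\mathcal{H}_\nabla f=(\partial_{x^i}\partial_{x^j}f-\Gamma_{ij}{}^k\partial_{x^k}f)\,dx^i\otimes dx^j$. For $\mu\in\mathbb{R}$, $E(\mu,\nabla)=\{f\in C^\infty(M):\mathcal{H}_\nabla f=\mu f\rho_{s,\nabla}\}$, a real vector space. Two connections $\nabla,\tilde\nabla$ are strongly projectively equivalent if there is a closed $1$-form $\omega$ with $\nabla_XY=\tilde\nabla_XY+\omega(X)Y+\omega(Y)X$ for all $X,Y$. The surface is strongly projectively flat if (locally) $\nabla$ is strongly projectively equivalent to a flat torsion free connection. *)

(* Defs.v *)
From Stdlib Require Import Reals.
From Coquelicot Require Import Coquelicot.
Open Scope R_scope.

(** A point has coordinates [(x^1, x^2) = (x, y)].  Functions, vector fields,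
    1-forms and Christoffel symbols are given by total functions of [x] and [y];
    only their values on the open set under consideration are meaningful, and
    every condition below is imposed on that set only. *)

Inductive idx : Set := i1 | i2.

Definition idx_eqb (i j : idx) : bool :=
  match i, j with i1, i1 | i2, i2 => true | _, _ => false end.

Definition sum_idx (F : idx -> R) : R := F i1 + F i2.

Definition scalar := R -> R -> R.
Definition domain := R -> R -> Prop.
Definition vfield := idx -> scalar.
Definition form1 := idx -> scalar.
(** [G i j k] is the Christoffel symbol Gamma_{ij}^k. *)
Definition christoffel := idx -> idx -> idx -> scalar.

Definition partial (i : idx) (f : scalar) : scalar := fun x y =>
  match i with
  | i1 => Derive (fun t => f t y) x
  | i2 => Derive (fun t => f x t) y
  end.

Definition open_2d (U : domain) : Prop :=
  forall x y, U x y -> locally_2d U x y.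

(** C^infinity on the open set [U]: [ex_diff_n f n x y] asks for the continuity
    of [f] and of all its iterated partial derivatives up to order [n]. *)
Definition smooth_on (U : domain) (f : scalar) : Prop :=
  forall (n : nat) x y, U x y -> ex_diff_n f n x y.

Definition smooth_vfield (U : domain) (X : vfield) : Prop :=
  forall k, smooth_on U (X k).

Definition smooth_form1 (U : domain) (w : form1) : Prop :=
  forall k, smooth_on U (w k).

Definition smooth_christoffel (U : domain) (G : christoffel) : Prop :=
  forall i j k, smooth_on U (G i j k).

Definition closed_form1 (U : domain) (w : form1) : Prop :=
  forall x y, U x y -> partial i1 (w i2) x y = partial i2 (w i1) x y.

Definition eval1 (w : form1) (X : vfield) : scalar := fun x y =>
  sum_idx (fun i => w i x y * X i x y).

Definition coord_vfield (i : idx) : vfield := fun k _ _ =>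
  if idx_eqb i k then 1 else 0.

Definition nabla (G : christoffel) (X Y : vfield) : vfield := fun k x y =>
  sum_idx (fun i => X i x y *
    (partial i (Y k) x y + sum_idx (fun j => G i j k x y * Y j x y))).

Definition lie_bracket (X Y : vfield) : vfield := fun k x y =>
  sum_idx (fun i => X i x y * partial i (Y k) x y - Y i x y * partial i (X k) x y).

Definition curvature (G : christoffel) (X Y Z : vfield) : vfield := fun k x y =>
  nabla G X (nabla G Y Z) k x y - nabla G Y (nabla G X Z) k x y
  - nabla G (lie_bracket X Y) Z k x y.

(** rho(X, Y) = Tr { Z |-> R(Z, X) Y }, the trace being taken in the
    coordinate frame. *)
Definition ricci (G : christoffel) (X Y : vfield) : scalar := fun x y =>
  sum_idx (fun k => curvature G (coord_vfield k) X Y k x y).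

Definition ricci_sym (G : christoffel) (X Y : vfield) : scalar := fun x y =>
  / 2 * (ricci G X Y x y + ricci G Y X x y).

(** The curvature and Ricci operators are tensors, so that they vanish exactly
    when they vanish on coordinate vector fields. *)
Definition flat_on (U : domain) (G : christoffel) : Prop :=
  forall i j k l x y, U x y ->
    curvature G (coord_vfield i) (coord_vfield j) (coord_vfield k) l x y = 0.

Definition ricci_zero_on (U : domain) (G : christoffel) : Prop :=
  forall i j x y, U x y -> ricci G (coord_vfield i) (coord_vfield j) x y = 0.

Definition torsion_free_on (U : domain) (G : christoffel) : Prop :=
  forall i j k x y, U x y -> G i j k x y = G j i k x y.

Definition strongly_projectively_equivalent_on (U : domain)
    (G G' : christoffel) : Prop :=
  exists w : form1, smooth_form1 U w /\ closed_form1 U w /\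
    forall X Y : vfield, smooth_vfield U X -> smooth_vfield U Y ->
    forall k x y, U x y ->
      nabla G X Y k x y =
        nabla G' X Y k x y + eval1 w X x y * Y k x y + eval1 w Y x y * X k x y.

Definition strongly_projectively_flat (M : domain) (G : christoffel) : Prop :=
  forall x y, M x y ->
  exists U : domain,
    open_2d U /\ U x y /\ (forall u v, U u v -> M u v) /\
    exists G' : christoffel,
      smooth_christoffel U G' /\ torsion_free_on U G' /\ flat_on U G' /\
      strongly_projectively_equivalent_on U G G'.

Definition hessian (G : christoffel) (f : scalar) (i j : idx) : scalar :=
  fun x y => partial i (partial j f) x y
             - sum_idx (fun k => G i j k x y * partial k f x y).

(** The equation H_nabla f = mu f rho_s defining E(mu, nabla). *)
Definition quasi_einstein (M : domain) (G : christoffel) (mu : R)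
    (f : scalar) : Prop :=
  smooth_on M f /\
  forall i j x y, M x y ->
    hessian G f i j x y =
      mu * f x y * ricci_sym G (coord_vfield i) (coord_vfield j) x y.

(** [V] is an [n]-dimensional space of functions on [M]: it has a basis
    [b 1, ..., b n].  Functions on [M] are represented by total functions, hence
    compared on [M] only; [sum_n_m a 1 n] is [a 1 + ... + a n], and 0 for
    [n = 0]. *)
Definition has_dim (M : domain) (V : scalar -> Prop) (n : nat) : Prop :=
  exists b : nat -> scalar,
    (forall i, (1 <= i <= n)%nat -> V (b i)) /\
    (forall c : nat -> R,
       (forall x y, M x y -> sum_n_m (fun i => c i * b i x y) 1 n = 0) ->
       forall i, (1 <= i <= n)%nat -> c i = 0) /\
    (forall f, V f -> exists c : nat -> R,
       forall x y, M x y -> f x y = sum_n_m (fun i => c i * b i x y) 1 n).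

Definition planar_map := idx -> scalar.

Definition maps_to (M : domain) (T : planar_map) (N : domain) : Prop :=
  forall x y, M x y -> N (T i1 x y) (T i2 x y).

(** [X'] restricted to the image of [T] is the push-forward of [X]. *)
Definition related (M : domain) (T : planar_map) (X X' : vfield) : Prop :=
  forall k x y, M x y ->
    X' k (T i1 x y) (T i2 x y) = sum_idx (fun i => partial i (T k) x y * X i x y).

(** [T_* (nabla_X Y) = nabla'_(T_* X) (T_* Y)]; this is used only for
    diffeomorphisms [T] of [M]. *)
Definition intertwines (M : domain) (T : planar_map) (G G' : christoffel) : Prop :=
  maps_to M T M /\
  forall X Y X' Y' : vfield,
    smooth_vfield M X -> smooth_vfield M Y ->
    smooth_vfield M X' -> smooth_vfield M Y' ->
    related M T X X' -> related M T Y Y' ->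
    related M T (nabla G X Y) (nabla G' X' Y').

Definition half_plane : domain := fun x _ => 0 < x.

Definition type_B_christoffel (C : idx -> idx -> idx -> R) : christoffel :=
  fun i j k x _ => / x * C i j k.

Definition type_B_surface (C : idx -> idx -> idx -> R) : Prop :=
  (forall i j k, C i j k = C j i k) /\
  ~ flat_on half_plane (type_B_christoffel C).

Definition shear (a b : R) : planar_map := fun k x y =>
  match k with i1 => x | i2 => a * x + b * y end.

Definition linearly_equivalent (C C' : idx -> idx -> idx -> R) : Prop :=
  exists a b : R, b <> 0 /\
    intertwines half_plane (shear a b)
      (type_B_christoffel C) (type_B_christoffel C').

Definition exceptional_case_1 (C : idx -> idx -> idx -> R) : Prop :=
  C i2 i2 i1 = 0 /\ C i2 i2 i2 = C i1 i2 i1 /\ C i1 i2 i1 <> 0.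

Definition exceptional_case_2 (C : idx -> idx -> idx -> R) : Prop :=
  exists eps : R, (eps = 1 \/ eps = -1) /\
    C i2 i2 i1 = eps /\ C i1 i2 i1 = 0 /\
    C i2 i2 i2 = 2 * eps * C i1 i1 i2 /\ 2 * eps * C i1 i1 i2 <> 0 /\
    C i1 i1 i1 = 1 + 2 * C i1 i2 i2 + eps * (C i1 i1 i2) ^ 2.

Definition exceptional (C : idx -> idx -> idx -> R) : Prop :=
  exists C' : idx -> idx -> idx -> R,
    type_B_surface C' /\ linearly_equivalent C C' /\
    (exceptional_case_1 C' \/ exceptional_case_2 C').

(* Main.v *)
(** A solution [F] of [H F = - F rho_s] satisfies a first-order consequence of the
    symmetry of its third derivatives.  In dimension two and for [mu = -1] the
    terms in [dF] cancel up to the alternating part of the Ricci tensor, which is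
    [(C_12^1 + C_22^2) / (2 x^2)].  If it is nonzero, [dF] is therefore a
    constant multiple of [F dx / x], so that [F = k x^al], and [x^al] is a
    solution exactly when [al] satisfies three polynomial equations, whose
    solvability is invariant under shears and can be read off after normalising
    to [C_22^1 = 0], or to [C_12^1 = 0] and [C_22^1 = 1, -1].  If it is zero,
    then [F = 0] or the Codazzi tensor of [rho] vanishes; in the latter case some
    [x^al] solves the equation, and [dlog (x^al)] is the 1-form of a strong
    projective equivalence with a flat connection. *)

Require Import Defs.
From Stdlib Require Import Reals Lra Lia Classical FunctionalExtensionality.
From Coquelicot Require Import Coquelicot.
Open Scope R_scope.

(** * Smooth functions on the half plane *)

Lemma half_plane_open : open_2d half_plane.
Proof.
  intros x y Hx; unfold half_plane in Hx.
  exists (mkposreal x Hx); intros u v Hu _; unfold half_plane; simpl in Hu.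
  apply Rabs_def2 in Hu; lra.
Qed.

Lemma locally_pos (x : R) : 0 < x -> locally x (fun t => 0 < t).
Proof. exact (open_gt 0 x). Qed.

Lemma partial_ext_half_plane (f g : scalar) (i : idx) :
  (forall x y, 0 < x -> f x y = g x y) ->
  forall x y, 0 < x -> partial i f x y = partial i g x y.
Proof.
  intros H x y Hx; destruct i; simpl.
  - apply Derive_ext_loc; eapply filter_imp; [|exact (locally_pos x Hx)]; auto.
  - apply Derive_ext; auto.
Qed.

Lemma smooth_partial (U : Defs.domain) (f : scalar) (i : idx) :
  smooth_on U f -> smooth_on U (partial i f).
Proof.
  intros f_smooth n x y Hxy.
  destruct (f_smooth (S n) x y Hxy) as (_ & _ & _ & H1 & H2).
  destruct i; assumption.
Qed.

Lemma smooth_continuity (U : Defs.domain) (f : scalar) (x y : R) :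
  smooth_on U f -> U x y -> continuity_2d_pt f x y.
Proof. intros f_smooth Hxy; exact (proj1 (f_smooth 0%nat x y Hxy)). Qed.

Lemma smooth_ex_derive_1 (U : Defs.domain) (f : scalar) (x y : R) :
  smooth_on U f -> U x y -> ex_derive (fun t => f t y) x.
Proof. intros f_smooth Hxy; exact (proj1 (proj2 (f_smooth 1%nat x y Hxy))). Qed.

Lemma smooth_ex_derive_2 (U : Defs.domain) (f : scalar) (x y : R) :
  smooth_on U f -> U x y -> ex_derive (fun t => f x t) y.
Proof. intros f_smooth Hxy; exact (proj1 (proj2 (proj2 (f_smooth 1%nat x y Hxy)))). Qed.

Lemma smooth_partial_comm (U : Defs.domain) (f : scalar) (x y : R) :
  open_2d U -> smooth_on U f -> U x y ->
  partial i1 (partial i2 f) x y = partial i2 (partial i1 f) x y.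
Proof.
  intros HU Hf Hxy.
  apply (Schwarz f).
  - destruct (HU x y Hxy) as [d Hd]; exists d; intros u v Hu Hv.
    specialize (Hd u v Hu Hv); repeat split.
    + exact (smooth_ex_derive_1 U f u v Hf Hd).
    + exact (smooth_ex_derive_2 U f u v Hf Hd).
    + exact (smooth_ex_derive_1 U _ u v (smooth_partial U f i2 Hf) Hd).
    + exact (smooth_ex_derive_2 U _ u v (smooth_partial U f i1 Hf) Hd).
  - exact (smooth_continuity U _ x y
      (smooth_partial U _ i1 (smooth_partial U f i2 Hf)) Hxy).
  - exact (smooth_continuity U _ x y
      (smooth_partial U _ i2 (smooth_partial U f i1 Hf)) Hxy).
Qed.

(** The chain rule along a shear needs total differentiability, which comes from the continuity of
    the partial derivative in [x]. *)
Lemma smooth_differentiable (U : Defs.domain) (f : scalar) (x y : R) :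
  open_2d U -> smooth_on U f -> U x y ->
  differentiable_pt_lim f x y (partial i1 f x y) (partial i2 f x y).
Proof.
  intros HU Hf Hxy.
  apply filterdiff_differentiable_pt_lim.
  apply (is_derive_filterdiff f x y (partial i1 f) (partial i2 f x y)).
  - destruct (proj1 (locally_2d_locally U x y) (HU x y Hxy)) as [d Hd].
    exists d; intros z Hz; apply Derive_correct.
    exact (smooth_ex_derive_1 U f _ _ Hf (Hd z Hz)).
  - apply Derive_correct, (smooth_ex_derive_2 U f x y Hf Hxy).
  - apply (proj1 (continuity_2d_pt_filterlim (partial i1 f) x y)).
    exact (smooth_continuity U _ x y (smooth_partial U f i1 Hf) Hxy).
Qed.

Lemma Rpower_is_derive (p x : R) :
  0 < x -> is_derive (fun t => Rpower t p) x (p * Rpower x (p - 1)).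
Proof. intros Hx; apply is_derive_Reals, derivable_pt_lim_power, Hx. Qed.

(** Induction on the order for all [k] and [p] at once: the multiples of powers of [x] are closed
    under both partial derivatives, the one in [y] having coefficient 0. *)
Lemma smooth_power (k p : R) :
  smooth_on half_plane (fun x _ => k * Rpower x p).
Proof.
  intros n; revert k p; induction n as [|n IH]; intros k p x y Hx.
  all: assert (Hc : continuity_2d_pt (fun u _ => k * Rpower u p) x y).
  1, 3: apply continuity_2d_pt_mult; [apply continuity_2d_pt_const|];
    apply (continuity_1d_2d_pt_comp (fun t => Rpower t p) (fun u _ => u));
    [|apply continuity_2d_pt_id1];
    apply derivable_continuous_pt;
    exists (p * Rpower x (p - 1)); apply derivable_pt_lim_power, Hx.
  - split; [exact Hc|exact I].
  - split; [exact Hc|split; [|split; [|split]]].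
    + apply ex_derive_mult; [apply ex_derive_const|].
      eexists; apply Rpower_is_derive, Hx.
    + apply ex_derive_const.
    + apply (ex_diff_n_ext_loc (fun u _ => (k * p) * Rpower u (p - 1)));
        [|apply IH, Hx].
      destruct (half_plane_open x y Hx) as [d Hd]; exists d; intros u v Hu Hv.
      specialize (Hd u v Hu Hv).
      rewrite Rmult_assoc; symmetry.
      apply is_derive_unique, is_derive_scal, Rpower_is_derive, Hd.
    + apply (ex_diff_n_ext_loc (fun u _ => 0 * Rpower u p)); [|apply IH, Hx].
      exists (mkposreal 1 Rlt_0_1); intros u v _ _; rewrite Derive_const; ring.
Qed.

Lemma smooth_ext (U : Defs.domain) (f g : scalar) :
  open_2d U -> (forall x y, U x y -> f x y = g x y) ->
  smooth_on U f -> smooth_on U g.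
Proof.
  intros HU Hfg Hf n x y Hxy; apply (ex_diff_n_ext_loc f); [|apply Hf, Hxy].
  destruct (HU x y Hxy) as [d Hd]; exists d; intros u v Hu Hv.
  apply Hfg, Hd; assumption.
Qed.

Lemma smooth_inv_x (k : R) : smooth_on half_plane (fun x _ => / x * k).
Proof.
  apply (smooth_ext _ (fun x _ => k * Rpower x (- (1))));
    [exact half_plane_open| |apply smooth_power].
  intros x y Hx; rewrite Rpower_Ropp, Rpower_1 by exact Hx; apply Rmult_comm.
Qed.

Lemma smooth_const (U : Defs.domain) (k : R) : smooth_on U (fun _ _ => k).
Proof.
  intros n; revert k; induction n as [|n IH]; intros k x y Hxy.
  - split; [apply continuity_2d_pt_const|exact I].
  - split; [apply continuity_2d_pt_const|].
    split; [apply ex_derive_const|split; [apply ex_derive_const|]].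
    split; (apply (ex_diff_n_ext_loc (fun _ _ => 0)); [|apply IH, Hxy]);
      exists (mkposreal 1 Rlt_0_1); intros u v _ _; rewrite Derive_const; reflexivity.
Qed.

(** * Curvature and Ricci tensor in terms of the constants [C] *)

Definition delta (i k : idx) : R := if idx_eqb i k then 1 else 0.

(** [x^2] times the curvature component [R_{ijk}^l] of the connection with
    Christoffel symbols [C / x]; the first two terms come from differentiating
    [1 / x]. *)
Definition curv_B (C : idx -> idx -> idx -> R) (i j k l : idx) : R :=
  delta j i1 * C i k l - delta i i1 * C j k l
  + sum_idx (fun m => C i m l * C j k m - C j m l * C i k m).

Definition ric_B (C : idx -> idx -> idx -> R) (j k : idx) : R :=
  sum_idx (fun i => curv_B C i j k i).

Definition rics_B (C : idx -> idx -> idx -> R) (j k : idx) : R :=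
  / 2 * (ric_B C j k + ric_B C k j).

(** An equality of functions, so that it can be rewritten inside a second covariant derivative. *)
Lemma nabla_B_coord (C : idx -> idx -> idx -> R) (j k : idx) :
  nabla (type_B_christoffel C) (coord_vfield j) (coord_vfield k)
  = fun l x _ => / x * C j k l.
Proof.
  extensionality l; extensionality x; extensionality y.
  unfold nabla, coord_vfield, type_B_christoffel, sum_idx, partial.
  destruct j, k, l; cbv [idx_eqb]; rewrite ?Derive_const; ring.
Qed.

Lemma partial_const (i : idx) (k : R) :
  partial i (fun _ _ => k) = fun _ _ => 0.
Proof.
  extensionality x; extensionality y; destruct i; simpl; apply Derive_const.
Qed.

Lemma partial_inv_x (i : idx) (k x y : R) :
  0 < x -> partial i (fun x _ => / x * k) x y = - delta i i1 * k * / x ^ 2.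
Proof.
  intros Hx; destruct i; unfold delta; cbn [partial idx_eqb].
  - apply is_derive_unique; auto_derive; [|field]; lra.
  - rewrite Derive_const; ring.
Qed.

Lemma lie_bracket_coord (i j : idx) :
  lie_bracket (coord_vfield i) (coord_vfield j) = fun _ _ _ => 0.
Proof.
  extensionality k; extensionality x; extensionality y.
  unfold lie_bracket, coord_vfield, sum_idx; rewrite !partial_const; ring.
Qed.

Lemma curvature_B_coord (C : idx -> idx -> idx -> R) (i j k l : idx) (x y : R) :
  0 < x ->
  curvature (type_B_christoffel C)
    (coord_vfield i) (coord_vfield j) (coord_vfield k) l x y
  = curv_B C i j k l * / x ^ 2.
Proof.
  intros Hx; unfold curvature; rewrite lie_bracket_coord, !nabla_B_coord.
  unfold nabla, sum_idx; rewrite !partial_inv_x by exact Hx.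
  unfold coord_vfield, type_B_christoffel, curv_B, sum_idx, delta.
  destruct i, j; cbv [idx_eqb]; field; lra.
Qed.

Lemma ricci_B_coord (C : idx -> idx -> idx -> R) (j k : idx) (x y : R) :
  0 < x ->
  ricci (type_B_christoffel C) (coord_vfield j) (coord_vfield k) x y
  = ric_B C j k * / x ^ 2.
Proof.
  intros Hx; unfold ricci, ric_B, sum_idx.
  rewrite !curvature_B_coord by exact Hx; ring.
Qed.

Lemma ricci_sym_B_coord (C : idx -> idx -> idx -> R) (j k : idx) (x y : R) :
  0 < x ->
  ricci_sym (type_B_christoffel C) (coord_vfield j) (coord_vfield k) x y
  = rics_B C j k * / x ^ 2.
Proof.
  intros Hx; unfold ricci_sym, rics_B.
  rewrite !ricci_B_coord by exact Hx; ring.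
Qed.

Lemma flat_B_iff (C : idx -> idx -> idx -> R) :
  flat_on half_plane (type_B_christoffel C)
  <-> forall i j k l, curv_B C i j k l = 0.
Proof.
  split.
  - intros H i j k l; specialize (H i j k l 1 0 Rlt_0_1).
    rewrite curvature_B_coord in H by lra; lra.
  - intros H i j k l x y Hx; rewrite curvature_B_coord, H by exact Hx; ring.
Qed.

(** * The equation as a second-order system and its integrability condition *)

Lemma quasi_einstein_B_hessian (C : idx -> idx -> idx -> R) (F : scalar)
    (i j : idx) (x y : R) :
  quasi_einstein half_plane (type_B_christoffel C) (-1) F -> 0 < x ->
  partial i (partial j F) x y
  = (C i j i1 * partial i1 F x y + C i j i2 * partial i2 F x y) / x
    - rics_B C i j * F x y / x ^ 2.
Proof.
  intros [_ HF] Hx; specialize (HF i j x y Hx).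
  rewrite ricci_sym_B_coord in HF by exact Hx.
  unfold hessian, type_B_christoffel, sum_idx in HF.
  match type of HF with ?A - ?B = ?D => assert (E : A = B + D) by lra end.
  rewrite E; field; lra.
Qed.

(** The shape is that of the right side of the Hessian equation; with [q] and [k] zero it also
    covers a first-order equation [dF = p F dx / x]. *)
Lemma partial_first_order (u v w : scalar) (p q k : R) (i : idx) (x y : R) :
  smooth_on half_plane u -> smooth_on half_plane v -> smooth_on half_plane w ->
  0 < x ->
  partial i (fun x y => (p * u x y + q * v x y) / x - k * w x y / x ^ 2) x y
  = (p * partial i u x y + q * partial i v x y) / x - k * partial i w x y / x ^ 2
    - delta i i1 * ((p * u x y + q * v x y) / x ^ 2 - 2 * k * w x y / x ^ 3).
Proof.
  intros Hu Hv Hw Hx; destruct i; unfold delta; cbn [partial idx_eqb];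
    apply is_derive_unique; auto_derive.
  - repeat split; try lra; try nra;
      eapply smooth_ex_derive_1; eassumption.
  - field; lra.
  - repeat split; eapply smooth_ex_derive_2; eassumption.
  - field; lra.
Qed.

(** [x^3] times the Codazzi tensor
    [(nabla_1 rho_s)(2, k) - (nabla_2 rho_s)(1, k)]. *)
Definition codazzi_B (C : idx -> idx -> idx -> R) (k : idx) : R :=
  - 2 * rics_B C i2 k
  - sum_idx (fun l => C i1 k l * rics_B C i2 l)
  + sum_idx (fun l => C i2 k l * rics_B C i1 l).

Lemma quasi_einstein_B_integrability (C : idx -> idx -> idx -> R) (F : scalar)
    (k : idx) (x y : R) :
  (forall i j k, C i j k = C j i k) ->
  quasi_einstein half_plane (type_B_christoffel C) (-1) F -> 0 < x ->
  (C i1 i2 i1 + C i2 i2 i2) * partial k F x y = - 2 * codazzi_B C k * F x y / x.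
Proof.
  intros HC HF Hx; pose proof (proj1 HF) as Hs.
  pose proof (smooth_partial_comm half_plane (partial k F) x y half_plane_open
    (smooth_partial _ F k Hs) Hx) as E.
  rewrite (partial_ext_half_plane (partial i2 (partial k F)) _ i1
    (fun x y Hx => quasi_einstein_B_hessian C F i2 k x y HF Hx) x y Hx) in E.
  rewrite (partial_ext_half_plane (partial i1 (partial k F)) _ i2
    (fun x y Hx => quasi_einstein_B_hessian C F i1 k x y HF Hx) x y Hx) in E.
  rewrite !partial_first_order in E
    by (assumption || (apply smooth_partial; assumption)).
  rewrite !(quasi_einstein_B_hessian C F _ _ x y HF Hx) in E.
  apply Rminus_diag_eq in E; apply Rminus_diag_uniq.
  (* This multiple of the difference of the mixed third derivatives is exactly the difference of the
     two sides of the claim. *)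
  match type of E with ?L = 0 => transitivity (- 2 * x ^ 2 * L); [|rewrite E; ring] end.
  unfold codazzi_B, rics_B, ric_B, curv_B, sum_idx, delta.
  rewrite !(HC i2 i1).
  destruct k; cbv [idx_eqb]; rewrite ?(HC i2 i1); field; lra.
Qed.

(** * Powers of [x] as solutions *)

(** The function [x^al] satisfies [H f = - f rho_s]. *)
Definition power_solves (C : idx -> idx -> idx -> R) (al : R) : Prop :=
  forall i j, delta i i1 * delta j i1 * (al * (al - 1)) - al * C i j i1
              + rics_B C i j = 0.

Lemma partial_power (k al : R) (i : idx) (x y : R) :
  0 < x ->
  partial i (fun x _ => k * Rpower x al) x y
  = delta i i1 * (k * al * Rpower x (al - 1)).
Proof.
  intros Hx; destruct i; unfold delta; cbn [partial idx_eqb].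
  - rewrite Rmult_1_l, Rmult_assoc.
    apply is_derive_unique, is_derive_scal, Rpower_is_derive, Hx.
  - rewrite Derive_const; ring.
Qed.

(** Each component of the equation is [x^(al-2)] times a component of [power_solves]. The factor
    [1 *] gives the function the form used in [smooth_power] and [partial_power]. *)
Lemma power_quasi_einstein (C : idx -> idx -> idx -> R) (al : R) :
  power_solves C al ->
  quasi_einstein half_plane (type_B_christoffel C) (-1)
    (fun x _ => 1 * Rpower x al).
Proof.
  intros H; split; [apply smooth_power|]; intros i j x y Hx; change (0 < x) in Hx.
  rewrite ricci_sym_B_coord by exact Hx.
  unfold hessian, type_B_christoffel, sum_idx.
  rewrite (partial_ext_half_plane (partial j _) _ i
    (fun x y Hx => partial_power 1 al j x y Hx) x y Hx).
  rewrite !partial_power by exact Hx.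
  rewrite (partial_ext_half_plane _
    (fun x _ => (delta j i1 * al) * Rpower x (al - 1)) i)
    by (assumption || (intros; ring)).
  rewrite partial_power by exact Hx.
  replace (al - 1 - 1) with (al - 2) by ring.
  assert (E1 : Rpower x (al - 1) = Rpower x (al - 2) * x).
  { rewrite <- (Rpower_1 x Hx) at 3; rewrite <- Rpower_plus; f_equal; ring. }
  assert (E2 : Rpower x al = Rpower x (al - 2) * x ^ 2).
  { replace (x ^ 2) with (x * x) by ring.
    rewrite <- Rmult_assoc, <- E1.
    rewrite <- (Rpower_1 x Hx) at 3; rewrite <- Rpower_plus; f_equal; ring. }
  rewrite E1, E2; specialize (H i j).
  set (P := Rpower x (al - 2)); apply Rminus_diag_uniq.
  transitivity (P * (delta i i1 * delta j i1 * (al * (al - 1)) - al * C i j i1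
    + rics_B C i j)); [|rewrite H; ring].
  change (delta i1 i1) with 1; change (delta i2 i1) with 0; field; lra.
Qed.

(** * Nonzero alternating Ricci part: every solution is a multiple of one power *)

Lemma eq_of_is_derive_0 (g : R -> R) (u v : R) :
  (forall t, Rmin u v <= t <= Rmax u v -> is_derive g t 0) -> g u = g v.
Proof.
  intros H; destruct (MVT_gen g u v (fun _ => 0)) as (c & _ & E).
  - intros t Ht; apply H; lra.
  - intros t Ht; apply derivable_continuous_pt; exists 0.
    apply is_derive_Reals, H, Ht.
  - lra.
Qed.

Lemma quasi_einstein_B_partial (C : idx -> idx -> idx -> R) (F : scalar) :
  (forall i j k, C i j k = C j i k) -> C i1 i2 i1 + C i2 i2 i2 <> 0 ->
  quasi_einstein half_plane (type_B_christoffel C) (-1) F ->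
  forall j x y, 0 < x ->
  partial j F x y
  = delta j i1 * (- 2 * codazzi_B C i1 / (C i1 i2 i1 + C i2 i2 i2)) * F x y / x.
Proof.
  intros HC Hn HF.
  set (n := C i1 i2 i1 + C i2 i2 i2) in *.
  set (v := fun k => - 2 * codazzi_B C k / n).
  (* Integrability divided by [n]; the zero terms put it in the form of [partial_first_order]. *)
  assert (HP : forall k x y, 0 < x -> partial k F x y
    = (v k * F x y + 0 * F x y) / x - 0 * F x y / x ^ 2).
  { intros k x y Hx.
    pose proof (quasi_einstein_B_integrability C F k x y HC HF Hx) as E.
    fold n in E; unfold v; apply (Rmult_eq_reg_l n); [|exact Hn].
    rewrite E; field; lra. }
  pose proof (proj1 HF) as Hs.
  intros j x y Hx; unfold delta; destruct j; cbv [idx_eqb];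
    rewrite (HP _ x y Hx); [unfold v; field; lra|].
  (* Equality of the mixed second derivatives leaves [v i2 * F / x^2 = 0]: only the derivative of
     [1 / x] fails to cancel. *)
  pose proof (smooth_partial_comm half_plane F x y half_plane_open Hs Hx) as E.
  rewrite !(partial_ext_half_plane (partial _ F) _ _ (HP _) x y Hx) in E.
  rewrite !partial_first_order in E by assumption.
  rewrite !(HP _ x y Hx) in E; unfold delta in E; cbn [idx_eqb] in E.
  apply Rminus_diag_eq in E.
  match type of E with ?L = 0 =>
    transitivity (- x * L); [field; lra|rewrite E; unfold Rdiv; ring] end.
Qed.

(** The solution does not depend on [y], and [F x^(-al)] has zero derivative in [x]; compare along
    the segment from [x] to 1, which stays in the half plane. *)
Lemma quasi_einstein_B_power (C : idx -> idx -> idx -> R) (F : scalar) :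
  (forall i j k, C i j k = C j i k) -> C i1 i2 i1 + C i2 i2 i2 <> 0 ->
  quasi_einstein half_plane (type_B_christoffel C) (-1) F ->
  forall x y, 0 < x ->
  F x y = F 1 0
    * Rpower x (- 2 * codazzi_B C i1 / (C i1 i2 i1 + C i2 i2 i2)).
Proof.
  intros HC Hn HF x y Hx.
  pose proof (quasi_einstein_B_partial C F HC Hn HF) as HP.
  set (al := - 2 * codazzi_B C i1 / (C i1 i2 i1 + C i2 i2 i2)) in *.
  pose proof (proj1 HF) as Hs.
  transitivity (F x 0).
  - apply (eq_of_is_derive_0 (fun t => F x t)); intros t _.
    replace 0 with (partial i2 F x t)
      by (rewrite HP by exact Hx; unfold delta; cbn [idx_eqb]; field; lra).
    apply Derive_correct, (smooth_ex_derive_2 _ F x t Hs Hx).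
  - assert (E : F x 0 * Rpower x (- al) = F 1 0 * Rpower 1 (- al)).
    { apply (eq_of_is_derive_0 (fun t => F t 0 * Rpower t (- al))); intros t Ht.
      assert (Ht0 : 0 < t).
      { apply Rlt_le_trans with (2 := proj1 Ht).
        apply Rmin_glb_lt; [exact Hx|exact Rlt_0_1]. }
      pose proof (HP i1 t 0 Ht0) as E; unfold delta in E; cbn [idx_eqb] in E.
      assert (ED : is_derive (fun t => F t 0) t (1 * al * F t 0 / t)).
      { rewrite <- E; apply Derive_correct, (smooth_ex_derive_1 _ F t 0 Hs Ht0). }
      evar_last.
      - apply (is_derive_mult (fun t => F t 0) (fun t => Rpower t (- al)));
          [exact ED|apply Rpower_is_derive, Ht0|intros; apply Rmult_comm].
      - unfold plus, mult; simpl.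
        replace (Rpower t (- al)) with (Rpower t (- al - 1) * t);
          [field; lra|].
        rewrite <- (Rpower_1 t Ht0) at 2; rewrite <- Rpower_plus; f_equal; ring. }
    assert (E1 : Rpower 1 (- al) = 1).
    { unfold Rpower; rewrite ln_1, Rmult_0_r; apply exp_0. }
    rewrite E1, Rmult_1_r in E; rewrite <- E, Rmult_assoc, <- Rpower_plus.
    rewrite Rplus_opp_l, Rpower_O by exact Hx; ring.
Qed.

(** At the point [(1, 0)] all powers of [x] are 1, so inserting [dF = al F dx / x] in the Hessian
    equation gives [F 1 0] times the polynomial condition. *)
Lemma quasi_einstein_B_power_solves (C : idx -> idx -> idx -> R) (F : scalar) :
  (forall i j k, C i j k = C j i k) -> C i1 i2 i1 + C i2 i2 i2 <> 0 ->
  quasi_einstein half_plane (type_B_christoffel C) (-1) F -> F 1 0 <> 0 ->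
  power_solves C (- 2 * codazzi_B C i1 / (C i1 i2 i1 + C i2 i2 i2)).
Proof.
  intros HC Hn HF HF0 i j.
  pose proof (quasi_einstein_B_partial C F HC Hn HF) as HP.
  set (al := - 2 * codazzi_B C i1 / (C i1 i2 i1 + C i2 i2 i2)) in *.
  pose proof (proj1 HF) as Hs; pose proof Rlt_0_1 as H1.
  pose proof (quasi_einstein_B_hessian C F i j 1 0 HF H1) as E.
  rewrite (partial_ext_half_plane (partial j F)
    (fun x y => (delta j i1 * al * F x y + 0 * F x y) / x - 0 * F x y / x ^ 2) i)
    in E by (assumption || (intros; rewrite HP by assumption; field; lra)).
  rewrite partial_first_order, !HP in E by assumption.
  apply (Rmult_eq_reg_l (F 1 0)); [|exact HF0].
  change (delta i1 i1) with 1 in E; change (delta i2 i1) with 0 in E; lra.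
Qed.

(** * Zero alternating Ricci part: Codazzi implies strong projective flatness *)

Lemma power_solves_of_codazzi (C : idx -> idx -> idx -> R) :
  (forall i j k, C i j k = C j i k) -> C i1 i2 i1 + C i2 i2 i2 = 0 ->
  (forall k, codazzi_B C k = 0) -> exists al, power_solves C al.
Proof.
  intros HC Hn HK; pose proof (HK i1) as K1; pose proof (HK i2) as K2; clear HK.
  assert (HS : forall al,
    al * (al - 1) - al * C i1 i1 i1 + rics_B C i1 i1 = 0 ->
    - al * C i1 i2 i1 + rics_B C i1 i2 = 0 ->
    - al * C i2 i2 i1 + rics_B C i2 i2 = 0 -> power_solves C al).
  { intros al H11 H12 H22 i j.
    assert (H21 : rics_B C i2 i1 = rics_B C i1 i2) by (unfold rics_B; ring).
    unfold delta; destruct i, j; cbv [idx_eqb]; rewrite ?(HC i2 i1), ?H21; lra. }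
  unfold codazzi_B, rics_B, ric_B, curv_B, sum_idx, delta in K1, K2, HS.
  cbv [idx_eqb] in K1, K2, HS; rewrite !(HC i2 i1) in K1, K2, HS.
  replace (C i2 i2 i2) with (- C i1 i2 i1) in * by lra; clear Hn HC.
  set (a := C i1 i1 i1) in *; set (b := C i1 i1 i2) in *.
  set (c := C i1 i2 i1) in *; set (d := C i1 i2 i2) in *.
  set (e := C i2 i2 i1) in *; clearbody a b c d e.
  (* For [e = 0] the condition [K2] reads [6 c^2 = 0], and then [al = d] solves all three
     equations. *)
  destruct (Req_dec e 0) as [->|He].
  - assert (Hc : c * c = 0) by lra.
    apply Rmult_integral in Hc; destruct Hc as [->| ->];
      exists d; apply HS; lra.
  (* The 22 equation [al e = rho_22] determines [al]. *)
  - set (al := (- e + a * e - d * e - 2 * c ^ 2) / e).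
    assert (Hal : al * e = - e + a * e - d * e - 2 * c ^ 2)
      by (unfold al; field; exact He).
    clearbody al.
    (* The combination [e K1 - c K2] eliminates [rho_11] and reduces to [c rho_22 = e rho_12], which
       is the 12 equation times [e]. The 11 equation then follows from [K2]. *)
    assert (H12 : al * c = - c + c * d - b * e).
    { apply (Rmult_eq_reg_l e); [|exact He].
      replace (e * (al * c)) with (c * (al * e)) by ring; rewrite Hal.
      pose proof (f_equal (Rmult e) K1); pose proof (f_equal (Rmult c) K2); lra. }
    exists al; apply HS; try lra.
    apply (Rmult_eq_reg_l e); [|exact He].
    pose proof (f_equal (Rmult al) Hal); pose proof (f_equal (Rmult c) H12).
    pose proof (f_equal (Rmult d) Hal); lra.
Qed.

Lemma curv_B_antisym (C : idx -> idx -> idx -> R) (i j k l : idx) :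
  curv_B C i j k l = - curv_B C j i k l.
Proof. unfold curv_B, sum_idx; ring. Qed.

(* Subtracting [dlog (x^al)] makes the Ricci tensor vanish; in dimension two it
   determines the curvature. *)
Lemma power_solves_strongly_projectively_flat (C : idx -> idx -> idx -> R)
    (al : R) :
  (forall i j k, C i j k = C j i k) -> C i1 i2 i1 + C i2 i2 i2 = 0 ->
  power_solves C al ->
  strongly_projectively_flat half_plane (type_B_christoffel C).
Proof.
  intros HC Hn Hal x y Hx.
  set (w := fun (i : idx) (x _ : R) => / x * (al * delta i i1)).
  set (C' := fun i j k =>
    C i j k - al * (delta i i1 * delta j k + delta j i1 * delta i k)).
  exists half_plane; split; [exact half_plane_open|].
  split; [exact Hx|]; split; [auto|].
  exists (type_B_christoffel C'); repeat split.
  - intros i j k; apply smooth_inv_x.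
  - intros i j k u v Hu; unfold type_B_christoffel, C'; rewrite (HC i j); ring.
  - apply flat_B_iff.
    assert (HR : forall k l, curv_B C' i1 i2 k l = 0).
    { pose proof (Hal i1 i1) as H11; pose proof (Hal i1 i2) as H12.
      pose proof (Hal i2 i2) as H22; clear Hal.
      unfold rics_B, ric_B, curv_B, sum_idx, delta in H11, H12, H22.
      cbv [idx_eqb] in H11, H12, H22; rewrite !(HC i2 i1) in H11, H12, H22.
      intros k l; unfold curv_B, C', sum_idx, delta; destruct k, l; cbv [idx_eqb];
        rewrite ?(HC i2 i1); replace (C i2 i2 i2) with (- C i1 i2 i1) in * by lra;
        lra. }
    intros i j k l; destruct i, j; try apply HR.
    + pose proof (curv_B_antisym C' i1 i1 k l); lra.
    + rewrite curv_B_antisym, HR; ring.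
    + pose proof (curv_B_antisym C' i2 i2 k l); lra.
  - exists w; repeat split.
    + intros k; apply smooth_inv_x.
    + intros u v Hu; unfold w; rewrite !partial_inv_x by exact Hu.
      unfold delta; cbn [idx_eqb]; ring.
    + intros X Y _ _ k u v _.
      unfold nabla, eval1, type_B_christoffel, C', w, sum_idx, delta.
      destruct k; cbv [idx_eqb]; ring.
Qed.

(** * Behaviour under shears *)

(** [jac s t i k] is the derivative of the [k]-th component of [shear s t] in
    the direction [i]. *)
Definition jac (s t : R) (i k : idx) : R :=
  match i, k with
  | i1, i1 => 1 | i1, i2 => s | i2, i1 => 0 | i2, i2 => t
  end.

Lemma partial_shear (s t : R) (i k : idx) :
  partial i (shear s t k) = fun _ _ => jac s t i k.
Proof.
  extensionality x; extensionality y.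
  destruct i, k; cbn [partial shear jac]; apply is_derive_unique;
    auto_derive; trivial; ring.
Qed.

(** Intertwining on the coordinate fields; the factor [1 / x] drops out because a shear preserves
    [x]. *)
Definition shear_related (s t : R) (C C' : idx -> idx -> idx -> R) : Prop :=
  forall i j k,
    sum_idx (fun m => sum_idx (fun n => jac s t i m * jac s t j n * C' m n k))
    = sum_idx (fun l => jac s t l k * C i j l).

Lemma intertwines_shear_related (C C' : idx -> idx -> idx -> R) (s t : R) :
  intertwines half_plane (shear s t)
    (type_B_christoffel C) (type_B_christoffel C') ->
  shear_related s t C C'.
Proof.
  intros [_ H] i j k.
  assert (Hr : forall i, related half_plane (shear s t) (coord_vfield i)
    (fun k _ _ => jac s t i k)).
  { intros i' k' x y _; unfold sum_idx; rewrite !partial_shear.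
    unfold coord_vfield; destruct i'; cbn [idx_eqb]; ring. }
  assert (Hc : forall i, smooth_vfield half_plane (coord_vfield i)).
  { intros i' k'; exact (smooth_const _ (delta i' k')). }
  assert (Hj : forall i, smooth_vfield half_plane (fun k _ _ => jac s t i k)).
  { intros i' k'; exact (smooth_const _ (jac s t i' k')). }
  specialize (H _ _ _ _ (Hc i) (Hc j) (Hj i) (Hj j) (Hr i) (Hr j) k 1 0 Rlt_0_1).
  rewrite nabla_B_coord in H.
  unfold nabla, sum_idx in H; rewrite !partial_const, !partial_shear in H.
  unfold type_B_christoffel in H; cbn [shear] in H; rewrite Rinv_1 in H.
  unfold sum_idx; lra.
Qed.

(** For arbitrary fields, the terms that differentiate [Y] agree by the chain rule, and the
    remaining ones are the relations weighted by [X^i Y^j / x]. *)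
Lemma shear_related_intertwines (C C' : idx -> idx -> idx -> R) (s t : R) :
  shear_related s t C C' ->
  intertwines half_plane (shear s t)
    (type_B_christoffel C) (type_B_christoffel C').
Proof.
  intros H; split; [intros x y Hx; exact Hx|].
  intros X Y X' Y' _ HY _ HY' RX RY k x y Hx.
  change (0 < x) in Hx.
  (* Both sides are the derivative in direction [i] of [Y' k] composed with the shear: the left by
     the chain rule, the right because [Y'] is the push-forward of [Y]. *)
  assert (chain : forall i, sum_idx (fun m => jac s t i m
      * partial m (Y' k) x (s * x + t * y))
    = sum_idx (fun l => jac s t l k * partial i (Y l) x y)).
  { intros i.
    pose proof (smooth_differentiable _ (Y' k) x (s * x + t * y)
      half_plane_open (HY' k) Hx) as D.
    transitivity (partial i (fun x y => Y' k x (s * x + t * y)) x y).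
    - transitivity (partial i1 (Y' k) x (s * x + t * y) * jac s t i i1
        + partial i2 (Y' k) x (s * x + t * y) * jac s t i i2);
        [unfold sum_idx; ring|].
      symmetry; destruct i; cbn [partial]; apply is_derive_unique, is_derive_Reals.
      + apply (derivable_pt_lim_comp_2d (Y' k) (fun u => u) (fun u => s * u + t * y));
          [exact D| |]; apply is_derive_Reals; auto_derive; trivial; simpl; ring.
      + apply (derivable_pt_lim_comp_2d (Y' k) (fun _ => x) (fun u => s * x + t * u));
          [exact D| |]; apply is_derive_Reals; auto_derive; trivial; simpl; ring.
    - rewrite (partial_ext_half_plane _
        (fun x y => jac s t i1 k * Y i1 x y + jac s t i2 k * Y i2 x y) i).
      + unfold sum_idx; generalize (jac s t i1 k) (jac s t i2 k); intros p q.
        destruct i; cbn [partial]; apply is_derive_unique;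
          auto_derive; try ring; repeat split.
        * exact (smooth_ex_derive_1 _ _ x y (HY i1) Hx).
        * exact (smooth_ex_derive_1 _ _ x y (HY i2) Hx).
        * exact (smooth_ex_derive_2 _ _ x y (HY i1) Hx).
        * exact (smooth_ex_derive_2 _ _ x y (HY i2) Hx).
      + intros u v Hu; specialize (RY k u v Hu); cbn [shear] in RY.
        rewrite RY; unfold sum_idx; rewrite !partial_shear; reflexivity.
      + exact Hx. }
  pose proof (chain i1) as chain1; pose proof (chain i2) as chain2; clear chain.
  pose proof (RX i1 x y Hx) as X1; pose proof (RX i2 x y Hx) as X2.
  pose proof (RY i1 x y Hx) as Y1; pose proof (RY i2 x y Hx) as Y2.
  unfold sum_idx in X1, X2, Y1, Y2; rewrite !partial_shear in X1, X2, Y1, Y2.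
  unfold nabla, sum_idx, type_B_christoffel; rewrite X1, X2, Y1, Y2.
  rewrite !partial_shear; cbn [shear].
  unfold sum_idx in chain1, chain2.
  assert (E : forall i j, X i x y * Y j x y * / x *
    (sum_idx (fun m => sum_idx (fun n => jac s t i m * jac s t j n * C' m n k))
    - sum_idx (fun l => jac s t l k * C i j l)) = 0).
  { intros i j; rewrite H; ring. }
  pose proof (E i1 i1) as E11; pose proof (E i1 i2) as E12.
  pose proof (E i2 i1) as E21; pose proof (E i2 i2) as E22.
  unfold sum_idx in E11, E12, E21, E22.
  pose proof (f_equal (Rmult (X i1 x y)) chain1).
  pose proof (f_equal (Rmult (X i2 x y)) chain2).
  lra.
Qed.

Lemma shear_related_solved (s t : R) (C C' : idx -> idx -> idx -> R) :
  t <> 0 -> shear_related s t C C' ->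
  forall i j,
    C i j i1 = sum_idx (fun m => sum_idx (fun n =>
      jac s t i m * jac s t j n * C' m n i1)) /\
    C i j i2 = (sum_idx (fun m => sum_idx (fun n =>
      jac s t i m * jac s t j n * C' m n i2)) - s * C i j i1) / t.
Proof.
  intros Ht H i j; pose proof (H i j i1) as E1; pose proof (H i j i2) as E2.
  unfold sum_idx in *; cbn [jac] in E1, E2; split; [rewrite E1; ring|].
  rewrite E2; simpl; field; exact Ht.
Qed.

Lemma rics_B_shear (s t : R) (C C' : idx -> idx -> idx -> R) (i j : idx) :
  (forall i j k, C' i j k = C' j i k) -> t <> 0 -> shear_related s t C C' ->
  rics_B C i j
  = sum_idx (fun m => sum_idx (fun n =>
      jac s t i m * jac s t j n * rics_B C' m n)).
Proof.
  intros HC' Ht H; pose proof (shear_related_solved s t C C' Ht H) as E.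
  unfold rics_B, ric_B, curv_B, sum_idx, delta.
  destruct i, j; cbv [idx_eqb];
    rewrite !(fun i j => proj2 (E i j)), !(fun i j => proj1 (E i j));
    unfold sum_idx; cbn [jac]; rewrite !(HC' i2 i1); field; exact Ht.
Qed.

(** A shear pulls [x^al] back to itself, so the three conditions form a bilinear form [P] that
    transforms as a tensor. The transformation is triangular and is inverted starting from the 22
    entry. *)
Lemma power_solves_shear (s t : R) (C C' : idx -> idx -> idx -> R) (al : R) :
  (forall i j k, C' i j k = C' j i k) -> t <> 0 -> shear_related s t C C' ->
  (power_solves C al <-> power_solves C' al).
Proof.
  intros HC' Ht H.
  set (P := fun (C : idx -> idx -> idx -> R) i j =>
    delta i i1 * delta j i1 * (al * (al - 1)) - al * C i j i1 + rics_B C i j).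
  assert (E : forall i j, P C i j = sum_idx (fun m => sum_idx (fun n =>
    jac s t i m * jac s t j n * P C' m n))).
  { intros i j; unfold P; rewrite (rics_B_shear s t C C' i j HC' Ht H).
    rewrite (proj1 (shear_related_solved s t C C' Ht H i j)).
    unfold sum_idx, delta; destruct i, j; cbv [idx_eqb jac]; ring. }
  change ((forall i j, P C i j = 0) <-> (forall i j, P C' i j = 0)).
  split; intros HP i j.
  - assert (E' : forall i j, sum_idx (fun m => sum_idx (fun n =>
      jac s t i m * jac s t j n * P C' m n)) = 0)
      by (intros; rewrite <- E; apply HP).
    pose proof (E' i1 i1) as E11; pose proof (E' i1 i2) as E12.
    pose proof (E' i2 i1) as E21; pose proof (E' i2 i2) as E22.
    unfold sum_idx in E11, E12, E21, E22; cbn [jac] in E11, E12, E21, E22.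
    assert (P22 : P C' i2 i2 = 0).
    { apply (Rmult_eq_reg_l (t * t)); [lra|].
      apply Rmult_integral_contrapositive_currified; exact Ht. }
    rewrite P22 in E11, E12, E21.
    assert (P12 : P C' i1 i2 = 0) by (apply (Rmult_eq_reg_l t); [lra|exact Ht]).
    assert (P21 : P C' i2 i1 = 0) by (apply (Rmult_eq_reg_l t); [lra|exact Ht]).
    rewrite P12, P21 in E11; destruct i, j; lra.
  - rewrite E; unfold sum_idx; rewrite !HP; ring.
Qed.

(** A 2-form scales by the determinant of the shear, which is [t]; hence the nonvanishing of this
    sum is a linear invariant. *)
Lemma alternating_ricci_shear (s t : R) (C C' : idx -> idx -> idx -> R) :
  (forall i j k, C' i j k = C' j i k) -> t <> 0 -> shear_related s t C C' ->
  C i1 i2 i1 + C i2 i2 i2 = t * (C' i1 i2 i1 + C' i2 i2 i2).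
Proof.
  intros HC' Ht H; pose proof (shear_related_solved s t C C' Ht H) as E.
  rewrite (proj2 (E i2 i2)), (proj1 (E i2 i2)), (proj1 (E i1 i2)).
  unfold sum_idx; cbn [jac]; field; exact Ht.
Qed.

(** * Surfaces with a power solution and the two normal forms *)

Lemma type_B_surface_of_alternating_ricci (C : idx -> idx -> idx -> R) :
  (forall i j k, C i j k = C j i k) -> C i1 i2 i1 + C i2 i2 i2 <> 0 ->
  type_B_surface C.
Proof.
  intros HC Hn; split; [exact HC|]; intros Hf; apply Hn.
  pose proof (proj1 (flat_B_iff C) Hf) as H.
  assert (E : ric_B C i1 i2 - ric_B C i2 i1 = 0)
    by (unfold ric_B, sum_idx; rewrite !H; ring).
  rewrite <- E; unfold ric_B, curv_B, sum_idx, delta; cbv [idx_eqb].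
  rewrite !(HC i2 i1); ring.
Qed.

Lemma power_solves_entries (C : idx -> idx -> idx -> R) (al : R) :
  (forall i j k, C i j k = C j i k) ->
  (power_solves C al <->
   al * (al - 1) - al * C i1 i1 i1 + C i1 i2 i2 + C i1 i1 i1 * C i1 i2 i2
     + C i1 i1 i2 * C i2 i2 i2 - C i1 i1 i2 * C i1 i2 i1 - C i1 i2 i2 ^ 2 = 0 /\
   - al * C i1 i2 i1 + (C i2 i2 i2 - C i1 i2 i1) / 2 + C i1 i2 i1 * C i1 i2 i2
     - C i1 i1 i2 * C i2 i2 i1 = 0 /\
   - al * C i2 i2 i1 - C i2 i2 i1 + C i1 i1 i1 * C i2 i2 i1
     - C i1 i2 i2 * C i2 i2 i1 + C i1 i2 i1 * C i2 i2 i2 - C i1 i2 i1 ^ 2 = 0).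
Proof.
  intros HC; unfold power_solves, rics_B, ric_B, curv_B, sum_idx, delta; split.
  - intros H; pose proof (H i1 i1) as H11; pose proof (H i1 i2) as H12.
    pose proof (H i2 i2) as H22; cbv [idx_eqb] in H11, H12, H22.
    rewrite !(HC i2 i1) in H11, H12, H22; repeat split; lra.
  - intros (H11 & H12 & H22) i j; destruct i, j; cbv [idx_eqb];
      rewrite !(HC i2 i1); lra.
Qed.

Lemma exceptional_power_solves (C : idx -> idx -> idx -> R) :
  exceptional C ->
  C i1 i2 i1 + C i2 i2 i2 <> 0 /\ exists al, power_solves C al.
Proof.
  intros (C' & [HC' _] & (s & t & Ht & Hi) & Hcase).
  apply intertwines_shear_related in Hi.
  rewrite (alternating_ricci_shear s t C C' HC' Ht Hi).
  assert (H : C' i1 i2 i1 + C' i2 i2 i2 <> 0 /\ exists al, power_solves C' al).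
  { destruct Hcase as [(He & Hf & Hc)|(eps & Heps & He & Hc & Hf & Hb & Ha)].
    (* The 12 equation becomes [C_12^1 (C_12^2 - al) = 0] and forces this exponent. *)
    - split; [lra|]; exists (C' i1 i2 i2).
      apply power_solves_entries; [exact HC'|].
      rewrite He, Hf; repeat split; lra.
    (* Here [C_12^1 = 0], and the 22 equation divided by [eps] gives the exponent. *)
    - split; [lra|]; exists (C' i1 i1 i1 - C' i1 i2 i2 - 1).
      apply power_solves_entries; [exact HC'|].
      rewrite He, Hc, Hf, Ha; clear - Heps.
      destruct Heps as [-> | ->]; repeat split; lra. }
  destruct H as [Hn [al Hal]]; split.
  - apply Rmult_integral_contrapositive_currified; assumption.
  - exists al; apply (power_solves_shear s t C C'); assumption.
Qed.

(** Scaling the second coordinate by [t] divides [C_22^1] by [t^2], so it can be normalised to its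
    sign. *)
Lemma signed_square (e : R) :
  e <> 0 -> exists eps t, (eps = 1 \/ eps = -1) /\ t <> 0 /\ e = eps * t ^ 2.
Proof.
  intros He; destruct (Rlt_le_dec 0 e) as [H|H].
  - exists 1, (sqrt e); split; [auto|split].
    + apply Rgt_not_eq, sqrt_lt_R0, H.
    + rewrite pow2_sqrt; lra.
  - assert (H' : 0 < - e) by lra.
    exists (-1), (sqrt (- e)); split; [auto|split].
    + apply Rgt_not_eq, sqrt_lt_R0, H'.
    + rewrite pow2_sqrt; lra.
Qed.

Lemma power_solves_exceptional (C : idx -> idx -> idx -> R) (al : R) :
  (forall i j k, C i j k = C j i k) -> C i1 i2 i1 + C i2 i2 i2 <> 0 ->
  power_solves C al -> exceptional C.
Proof.
  intros HC Hn Hal.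
  destruct (Req_dec (C i2 i2 i1) 0) as [He|He].
  - exists C; split; [apply type_B_surface_of_alternating_ricci; assumption|].
    split.
    + exists 0, 1; split; [exact R1_neq_R0|].
      apply shear_related_intertwines; intros i j k; unfold sum_idx.
      destruct i, j, k; cbn [jac]; ring.
    + left; apply power_solves_entries in Hal; [|exact HC].
      destruct Hal as (_ & H12 & H22); rewrite He in H12, H22.
      (* This is the 22 equation. If [C_12^1] vanished, the 12 equation would make [C_22^2] vanish
         too, against [Hn]. *)
      assert (Hcf : C i1 i2 i1 * (C i2 i2 i2 - C i1 i2 i1) = 0) by lra.
      apply Rmult_integral in Hcf; destruct Hcf as [Hc|Hf].
      * rewrite Hc in H12; lra.
      * split; [exact He|]; split; lra.
  - destruct (signed_square _ He) as (eps & t & Heps & Ht & Het).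
    assert (He2 : eps * eps = 1) by (destruct Heps as [-> | ->]; ring).
    (* The shear coefficient is chosen to kill [C_12^1], the scaling to
       normalise [C_22^1] to [eps]. *)
    set (s := eps * C i1 i2 i1 / t).
    (* [f'] and [d'] are the values of the new [C_22^2] and [C_12^2] that [shear_related] forces in
       upper index 2. *)
    set (f' := (s * C i2 i2 i1 + t * C i2 i2 i2) / t ^ 2).
    set (d' := (s * C i1 i2 i1 + t * C i1 i2 i2) / t - s * f').
    set (C' := fun i j k => match i, j, k with
      | i1, i1, i1 => C i1 i1 i1 - s ^ 2 * eps
      | i1, i1, i2 => s * C i1 i1 i1 + t * C i1 i1 i2 - 2 * s * d' - s ^ 2 * f'
      | i2, i2, i1 => eps
      | i2, i2, i2 => f'
      | _, _, i1 => 0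
      | _, _, i2 => d'
      end).
    assert (HC' : forall i j k, C' i j k = C' j i k)
      by (intros i j k; destruct i, j, k; reflexivity).
    assert (Hs : s * eps * t = C i1 i2 i1).
    { transitivity (eps * eps * C i1 i2 i1);
        [unfold s; field; exact Ht|rewrite He2; ring]. }
    assert (Hf : t ^ 2 * f' = s * C i2 i2 i1 + t * C i2 i2 i2)
      by (unfold f'; field; exact Ht).
    assert (Hd : t * d' = s * C i1 i2 i1 + t * C i1 i2 i2 - t * s * f')
      by (unfold d'; field; exact Ht).
    assert (Hsh : shear_related s t C C').
    { clearbody s f' d'.
      intros i j k; unfold sum_idx; destruct i, j, k; cbn [jac C'];
        rewrite ?(HC i2 i1); lra. }
    assert (Hal' : power_solves C' al)
      by (apply (power_solves_shear s t C C'); assumption).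
    rewrite (alternating_ricci_shear s t C C' HC' Ht Hsh) in Hn.
    assert (Hn' : C' i1 i2 i1 + C' i2 i2 i2 <> 0)
      by (intros E; apply Hn; rewrite E; ring).
    exists C'; split; [apply type_B_surface_of_alternating_ricci; assumption|].
    split; [exists s, t; split; [exact Ht|]; apply shear_related_intertwines, Hsh|].
    right; exists eps; apply power_solves_entries in Hal'; [|exact HC'].
    change (C' i2 i2 i1) with eps in *; change (C' i1 i2 i1) with 0 in *.
    clearbody C'; destruct Hal' as (H11 & H12 & H22).
    (* The 12 equation gives [C_22^2], the 22 equation gives [al], and inserting both in the 11
       equation gives the condition on [C_11^1]. *)
    assert (Hf' : C' i2 i2 i2 = 2 * eps * C' i1 i1 i2) by lra.
    assert (Ha : al = C' i1 i1 i1 - C' i1 i2 i2 - 1).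
    { destruct Heps as [-> | ->]; lra. }
    repeat split; try assumption; try lra.
    rewrite Ha, Hf' in H11; lra.
Qed.

(** * Counting dimensions *)

Lemma has_dim_0 (M : Defs.domain) (V : scalar -> Prop) :
  (forall f, V f -> forall x y, M x y -> f x y = 0) -> has_dim M V 0.
Proof.
  intros H; exists (fun _ _ _ => 0); split; [intros i Hi; lia|].
  split; [intros c _ i Hi; lia|].
  intros f Hf; exists (fun _ => 0); intros x y Hxy.
  rewrite sum_n_m_zero by lia; exact (H f Hf x y Hxy).
Qed.

Lemma has_dim_1 (M : Defs.domain) (V : scalar -> Prop) (b : scalar) (x y : R) :
  V b -> M x y -> b x y <> 0 ->
  (forall f, V f -> exists k, forall u v, M u v -> f u v = k * b u v) ->
  has_dim M V 1.
Proof.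
  intros Hb Hxy Hbn H; exists (fun _ => b); split; [auto|split].
  - intros c Hc i Hi; specialize (Hc x y Hxy); rewrite sum_n_n in Hc.
    apply Rmult_integral in Hc; replace i with 1%nat by lia.
    destruct Hc; [assumption|contradiction].
  - intros f Hf; destruct (H f Hf) as [k Hk]; exists (fun _ => k).
    intros u v Huv; rewrite sum_n_n; apply Hk, Huv.
Qed.

Theorem theorem1p15 (C : idx -> idx -> idx -> R)
    (surface : type_B_surface C)
    (ricci_nonzero : ~ ricci_zero_on half_plane (type_B_christoffel C))
    (not_spf : ~ strongly_projectively_flat half_plane (type_B_christoffel C)) :
  (~ exceptional C ->
     has_dim half_plane
       (quasi_einstein half_plane (type_B_christoffel C) (-1)) 0) /\
  (exceptional C ->
     has_dim half_plane
       (quasi_einstein half_plane (type_B_christoffel C) (-1)) 1).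
Proof.
  destruct surface as [HC _]; split.
  - intros Hne; apply has_dim_0; intros F HF x y Hx; change (0 < x) in Hx.
    destruct (Req_dec (C i1 i2 i1 + C i2 i2 i2) 0) as [Hn|Hn].
    (* Otherwise some [x^al] would solve the equation and make the surface strongly projectively
       flat. Integrability now reads [codazzi_B C k * F = 0]. *)
    + assert (HK : exists k, codazzi_B C k <> 0).
      { apply NNPP; intros HK; apply not_spf.
        destruct (power_solves_of_codazzi C HC Hn) as [al Hal].
        - intros k; apply NNPP; intros Hk; apply HK; exists k; exact Hk.
        - exact (power_solves_strongly_projectively_flat C al HC Hn Hal). }
      destruct HK as [k Hk].
      pose proof (quasi_einstein_B_integrability C F k x y HC HF Hx) as E.
      rewrite Hn in E; apply (Rmult_eq_reg_l (codazzi_B C k)); [|exact Hk].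
      apply (f_equal (Rmult x)) in E.
      replace (x * (-2 * codazzi_B C k * F x y / x))
        with (-2 * (codazzi_B C k * F x y)) in E by (field; lra).
      lra.
    + rewrite (quasi_einstein_B_power C F HC Hn HF x y Hx).
      destruct (Req_dec (F 1 0) 0) as [->|HF0]; [ring|].
      exfalso; apply Hne; eapply power_solves_exceptional; [exact HC|exact Hn|].
      exact (quasi_einstein_B_power_solves C F HC Hn HF HF0).
  - intros He; destruct (exceptional_power_solves C He) as [Hn [al Hal]].
    pose proof (power_quasi_einstein C al Hal) as Hb.
    assert (H1 : 1 * Rpower 1 al <> 0)
      by (apply Rgt_not_eq; unfold Rpower; rewrite Rmult_1_l; apply exp_pos).
    apply (has_dim_1 half_plane _ _ 1 0 Hb Rlt_0_1 H1).
    (* [F] and the basis function are multiples of the same power, so their ratio is read off at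
       [(1, 0)]. *)
    intros F HF; exists (F 1 0 / (1 * Rpower 1 al)); intros x y Hx.
    rewrite (quasi_einstein_B_power C F HC Hn HF x y Hx).
    rewrite (quasi_einstein_B_power C _ HC Hn Hb x y Hx).
    field; lra.
Qed.
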